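(* Let $(\mathcal{C},\Lambda)$ be a concrete category admitting a universally free object (UFO) $\mathsf F$. Then there exists a projectively universal morphism $u\in\mathrm{Mor}(\mathsf F)$, that is, a morphism $u\colon\mathsf F\to\mathsf F$ such that for every $B\in\mathcal{C}$ and every $\tau\in\mathrm{Mor}(B)$ there exists an epimorphism $\pi\colon\mathsf F\to B$ with $$\pi\circ u=\tau\circ\pi .$$
   Context: A concrete category is a pair $(\mathcal{C},\Lambda)$, where $\mathcal C$ is a category and $\Lambda\colon\mathcal{C}\to\mathsf{Set}$ is a fixed faithful (forgetful) functor to the category of all sets. For objects $B,C$ of $\mathcal C$, $\mathrm{Mor}(B,C)$ denotes the class of morphisms from $B$ to $C$, and $\mathrm{Mor}(B)=\mathrm{Mor}(B,B)$. Free object: an object $F\in\mathcal{C}$ is free on a set $X$, written $F=F(X)$, when it comes equipped with a map $\eta_X\colon X\to\Lambda(F)$ such that for every $B\in\mathcal{C}$ and every function $f\colon X\to\Lambda(B)$ there exists a unique morphism $\beta f\in\mathrm{Mor}(F,B)$ with $\Lambda(\beta f)\circ\eta_X=f$. The morphism $\beta f$ is called the free extension of $f$. Universally free object (UFO): a free object $\mathsf F=F(X)$ in $\mathcal{C}$, where $X$ is a set, such that for every $B\in\mathcal{C}$ there exists an injection $\iota\colon X\to\Lambda(B)$ whose free extension $\beta\iota\colon\mathsf F\to B$ is an epimorphism.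
   Formalization: The set X on which the universally free object F = F(X) is free is assumed to be empty or infinite; for nonempty finite X the claim can fail (e.g. the one-object category Z/2 acting on itself by translation, with X a point). *)

(* Defs.v *)
From mathcomp Require Import all_boot.
From mathcomp Require Import boolp.

Set Implicit Arguments.
Unset Strict Implicit.
Unset Printing Implicit Defensive.

Record category := Category {
  Ob :> Type;
  Mor : Ob -> Ob -> Type;
  idm : forall A : Ob, Mor A A;
  compm : forall A B C : Ob, Mor B C -> Mor A B -> Mor A C;
  compm1 : forall (A B : Ob) (f : Mor A B), compm f (idm A) = f;
  comp1m : forall (A B : Ob) (f : Mor A B), compm (idm B) f = f;
  compmA : forall (A B C D : Ob) (h : Mor C D) (g : Mor B C) (f : Mor A B),
    compm h (compm g f) = compm (compm h g) f
}.

Arguments idm {c} A.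

Declare Scope cat_scope.
Delimit Scope cat_scope with cat.
Notation "g \* f" := (compm g f) (at level 40, left associativity) : cat_scope.
Local Open Scope cat_scope.

Definition epi (C : category) (A B : C) (p : Mor A B) : Prop :=
  forall (D : C) (g h : Mor B D), g \* p = h \* p -> g = h.

Record functor (C D : category) := Functor {
  fob :> C -> D;
  fmor : forall A B : C, Mor A B -> Mor (fob A) (fob B);
  fmor1 : forall A : C, fmor (idm A) = idm (fob A);
  fmorM : forall (A B E : C) (g : Mor B E) (f : Mor A B),
    fmor (g \* f) = fmor g \* fmor f
}.

Definition faithful (C D : category) (L : functor C D) : Prop :=
  forall (A B : C) (f g : Mor A B), fmor L f = fmor L g -> f = g.

(* The types of one fixed universe play the role of the sets. [category] sits
   strictly above that universe, so that classes of objects may be proper. *)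
Definition set_univ := Type.

Definition SET : category :=
  @Category set_univ (fun X Y => X -> Y) (fun X x => x)
    (fun X Y Z g f => g \o f)
    (fun X Y f => erefl) (fun X Y f => erefl) (fun X Y Z W h g f => erefl).

Record concrete_category := ConcreteCategory {
  cat_of :> category;
  forget : functor cat_of SET;
  forget_faithful : faithful forget
}.

Arguments forget {c}.

Section Free.
Variables (C : concrete_category) (X : set_univ) (F : C).

Definition is_free (eta : X -> forget F) : Prop :=
  forall (B : C) (f : X -> forget B),
    exists! b : Mor F B, fmor forget b \o eta = f.

Variables (eta : X -> forget F) (freeF : is_free eta).

Definition free_ext (B : C) (f : X -> forget B) : Mor F B :=
  sval (cid (freeF f)).

Definition universally_free : Prop :=
  forall B : C, exists2 i : X -> forget B, injective i & epi (free_ext i).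

End Free.

Definition projectively_universal (C : category) (F : C) (u : Mor F F) : Prop :=
  forall (B : C) (t : Mor B B),
    exists2 p : Mor F B, epi p & p \* u = t \* p.

(* Main.v *)
(** Since X is empty or infinite, X is in bijection with X * nat.  Let u be the
    endomorphism of F induced by the shift (x, n) |-> (x, n + 1).  Given t on B
    and i : X -> B whose free extension is an epimorphism, the map p extending
    (x, n) |-> t^n (i x) satisfies p u = t p, and it is an epimorphism because
    the free extension of i factors through p by way of x |-> (x, 0). *)
Require Import Defs.
From mathcomp Require Import all_boot.
From mathcomp Require Import boolp classical_sets functions cardinality.

Set Implicit Arguments.
Unset Strict Implicit.
Unset Printing Implicit Defensive.

Local Open Scope classical_set_scope.
Local Open Scope card_scope.
Local Open Scope cat_scope.

Lemma infinite_set_seq (T : Type) (A : set T) :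
  infinite_set A -> exists2 h : nat -> T, injective h & range h `<=` A.
Proof.
elim/Ppointed: T => T in A *.
  by rewrite (empty_eq0 A) => /(_ (finite_set0 _)).
move=> /infiniteP /pcard_leP[h]; exists h.
  by move=> m n /inj -> //; rewrite inE.
by move=> _ [n _ <-]; exact: funS.
Qed.

(** Choice in the form of maximality: with [E] a maximal family of injective sequences with disjoint
    ranges, [T * nat] is an image of [E * nat], which embeds into [T]. *)
Lemma card_setX_nat (T : Type) :
  infinite_set [set: T] -> [set: T * nat] #= [set: T].
Proof.
move=> infT; apply: Cantor_Bernstein; last first.
  have injT : {in [set: T] &, injective (fun x : T => (x, 0))} by move=> x y _ _ [].
  have /card_eqPle[_ leT] := inj_card_eq injT.
  exact: card_le_trans leT (card_leT _).
(* T is partitioned into countable ranges of sequences, up to a finite rest. *)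
have [E [Einj Etriv Emax]] := ex_maximal_disjoint_subcollection
  (fun h : nat -> T => range h) [set h | injective h].
pose rest := ~` \bigcup_(h in E) range h.
have fin_rest : finite_set rest.
  (* An infinite [rest] would contain the range of an injective [h], and adding [h] to [E] would
     contradict maximality. *)
  apply: contrapT => /infinite_set_seq[h injh hrest].
  have hdisj g : E g -> range g `&` range h = set0.
    move=> Eg; rewrite -subset0 => x [gx hx].
    by apply: (hrest x hx); exists g.
  apply: (Emax (E `|` [set h])).
  (* The extension is strict: if [h] were in [E], its range would be disjoint from itself, hence
     empty. *)
  - split; first exact: subsetUl.
    move=> /(_ h (or_intror erefl)) Eh.
    have := hdisj _ Eh; rewrite setIid => /(congr1 (@^~ (h 0))) /= h0.
    by have : False by rewrite -h0; exists 0.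
  - by move=> g [/Einj|->].
  - move=> f g [Ef|->] [Eg|->] // [x [fx gx]].
    + by apply: Etriv => //; exists x.
    + have : set0 x by rewrite -(hdisj _ Ef).
      by [].
    + have : set0 x by rewrite -(hdisj _ Eg).
      by [].
have [h0 Eh0] : E !=set0.
  apply/set0P/eqP => E0; apply: infT.
  by move: fin_rest; rewrite /rest E0 bigcup_set0 setC0.
have [r rP] : exists r : nat -> T, rest `<=` range r.
  have /countable_injP[f finj] := finite_set_countable fin_rest.
  (* [r] inverts the injection [f] of [rest] into [nat]; the default [h0 0] is harmless, since
     [rest] only has to be covered. *)
  exists (fun n => if pselect (exists2 x, rest x & f x = n) is left e
                   then s2val (cid2 e) else h0 0) => x rx.
  exists (f x) => //; case: pselect => [e|[]]; last by exists x.
  by case: cid2 => y /= ry fyx; apply: finj => //; exact: mem_set.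
apply: (@card_le_trans _ _ _ (E `*` [set: nat])); last first.
  apply: card_le_trans (card_leT ((fun p => p.1 p.2) @` (E `*` [set: nat]))).
  (* A value determines its sequence by disjointness of the ranges, then its index by
     injectivity. *)
  have inj_ev : {in E `*` [set: nat] &, injective (fun p => p.1 p.2)}.
    move=> [f m] [g n] /set_mem[/= Ef _] /set_mem[/= Eg _] fg.
    have e : f = g.
      by apply: Etriv => //; exists (f m); split; [exists m | rewrite fg; exists n].
    by rewrite -e in fg *; rewrite (Einj f Ef _ _ fg).
  by have /card_eqPle[_] := inj_card_eq inj_ev.
(* One natural number codes a tag, an index [k] and the second coordinate [m]. The tag selects [h k]
   or [r k], so the copy of [nat] over [h0] also absorbs the countable [rest * nat]. *)
pose dec (k : nat) : option (bool * nat * nat) := unpickle k.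
pose F (p : (nat -> T) * nat) : T * nat :=
  if dec p.2 is Some (b, k, m) then (if b then p.1 k else r k, m) else (h0 0, 0).
apply: card_le_trans (card_image_le F _).
apply: subset_card_le => -[x m] _.
have [[h Eh [k _ hk]]|/rP[k _ rk]] := pselect ((\bigcup_(h in E) range h) x).
  by exists (h, pickle (true, k, m)); rewrite // /F /dec /= pickleK hk.
by exists (h0, pickle (false, k, m)); rewrite // /F /dec /= pickleK rk.
Qed.

Lemma infinite_bij_nat (T : Type) :
  infinite_set [set: T] -> exists e : T * nat -> T, bijective e.
Proof.
elim/Ppointed: T => T infT.
  by case: infT; rewrite (empty_eq0 setT); exact: finite_set0.
have /card_set_bijP[e] := card_setX_nat infT.
by rewrite setTT_bijective; exists e.
Qed.

Lemma fmor_compE (C : concrete_category) (A B D : C)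
    (g : Mor B D) (f : Mor A B) (y : forget A) :
  fmor forget (g \* f) y = fmor forget g (fmor forget f y).
Proof. by rewrite fmorM. Qed.

Section FreeExtension.
Variables (C : concrete_category) (X : set_univ) (F : C).
Variables (eta : X -> forget F) (freeF : is_free eta).

Lemma free_extE (B : C) (f : X -> forget B) (x : X) :
  fmor forget (free_ext freeF f) (eta x) = f x.
Proof.
by rewrite /free_ext; case: cid => b [/= be _]; exact: (congr1 (@^~ x) be).
Qed.

Lemma free_hom_ext (B : C) (g h : Mor F B) :
  (forall x, fmor forget g (eta x) = fmor forget h (eta x)) -> g = h.
Proof.
move=> gh; have [b [_ bu]] := freeF (fmor forget h \o eta).
by rewrite -(bu g) ?(bu h) //; apply/funext.
Qed.

End FreeExtension.

Lemma epi_factor (C : category) (A B D : C) (p : Mor B D) (q : Mor A B) :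
  epi (p \* q) -> epi p.
Proof. by move=> epq E g h gh; apply: epq; rewrite !compmA gh. Qed.

Theorem theoremA (C : concrete_category) (X : set_univ) (F : C)
    (eta : X -> forget F) (freeF : is_free eta)
    (ufoF : universally_free freeF)
    (cardX : [set: X]%classic = set0 \/ infinite_set [set: X]%classic) :
  exists u : Mor F F, projectively_universal u.
Proof.
have [e [d ed de]] : exists e : X * nat -> X, bijective e.
  case: cardX => [X0|/infinite_bij_nat//].
    have noX (x : X) : False by have : [set: X] x by []; rewrite X0.
  (* For empty [X] both sides are empty, so any map is a bijection. *)
  by exists fst; exists (fun x => (x, 0)) => [[x n]|x //]; case: (noX x).
exists (free_ext freeF (fun x => eta (e ((d x).1, (d x).2.+1)))) => B t.
have [i _ epi_i] := ufoF B.
pose orbit x := iter (d x).2 (fmor forget t) (i (d x).1).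
exists (free_ext freeF orbit).
  apply: (@epi_factor _ _ _ _ _ (free_ext freeF (fun x => eta (e (x, 0))))).
  rewrite [X in epi X](_ : _ = free_ext freeF i) //.
  apply: (free_hom_ext freeF) => x.
  by rewrite fmor_compE !free_extE /orbit ed.
(* On generators, the shift adds one to the exponent, which is one more application of [t] on the
   outside of [iter]. *)
apply: (free_hom_ext freeF) => x.
by rewrite !fmor_compE !free_extE /orbit ed.
Qed.
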